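(* For each $n\ge 3$, let $$a_{ij}^{(n)}=\begin{cases}\dfrac{(j+1)(4n-j+1)}{8} & \text{if } j \text{ is odd and } i\ge j-1,\\[2mm] \dfrac{(j+2)(4n-j)}{32} & \text{if } j\text{ is even and } i=j-1,\\[1mm] 0 & \text{otherwise,}\end{cases}$$ and let $A^{(n)}=(a_{ij}^{(n)})_{1\le i\le n-2,\ 1\le j\le n-1}$, an $(n-2)\times(n-1)$ matrix. Let $b_n$ be the first component of the row vector $A^{(3)}A^{(4)}\cdots A^{(n)}$. Then, for every $n\ge 3$, $$\zeta(2n)=\frac{\pi^{2n}}{(2n)!}\cdot\frac{4^{n-1}}{4^n-1}\,b_n .$$ Therefore $$B_{2n}=(-1)^{n+1}\frac{b_n}{2(4^n-1)}\qquad\text{and}\qquad \tan^{(2n-1)}(0)=\frac{4^{n-1}}{n}\,b_n .$$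
   Context: $\zeta$ is the Riemann zeta function. The Bernoulli numbers $B_n$ are defined by $\frac{z}{e^z-1}=\sum_{n\ge 0}B_n\frac{z^n}{n!}$ for $|z|<2\pi$. $\tan^{(k)}(0)$ denotes the $k$-th derivative of the tangent function at $0$. *)

(* Defs.v *)
From Stdlib Require Import Reals Arith.
From Coquelicot Require Import Coquelicot.

Open Scope R_scope.

(* The Dirichlet series of the Riemann zeta function, which converges for real
   [s > 1]; [Series] is total, so [zeta s] is only meaningful there. *)
Definition zeta (s : R) : R := Series (fun k : nat => / Rpower (INR (S k)) s).

(* [e^(x + i y) = e^x (cos y + i sin y)] *)
Definition Cexp (z : C) : C := (exp (fst z) * cos (snd z), exp (fst z) * sin (snd z)).

(* The singularity of [z / (e^z - 1)] at [0] is removable, and a power series is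
   determined by its values off [0], so [z = 0] can be left out (Coquelicot's
   [0 / 0] is not the limit [1]). In [0 < |z| < 2 pi] the denominator does not
   vanish, and exactly one sequence [B] satisfies this predicate. *)
Definition is_bernoulli (B : nat -> C) : Prop :=
  forall z : C, z <> RtoC 0 -> Cmod z < 2 * PI ->
    @is_pseries C_AbsRing C_NormedModule
      (fun k : nat => (B k / RtoC (INR (fact k)))%C) z
      (z / (Cexp z - RtoC 1))%C.

(* The indices [i] and [j] start at 1. *)
Definition a_entry (n i j : nat) : R :=
  if (Nat.odd j && (j - 1 <=? i)%nat)%bool then
    (INR j + 1) * (4 * INR n - INR j + 1) / 8
  else if (Nat.even j && (i =? j - 1)%nat)%bool then
    (INR j + 2) * (4 * INR n - INR j) / 32
  else 0.

(* Coquelicot matrices are indexed from 0. *)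
Definition matA (n : nat) : @matrix R (n - 2) (n - 1) :=
  mk_matrix (n - 2) (n - 1) (fun i j : nat => a_entry n (S i) (S j)).

(* [prodA m] is [A^(3) A^(4) ... A^(m + 3)]; the dimensions match because
   [S n - 2] and [n - 1] are convertible for [n = m + 3]. *)
Fixpoint prodA (m : nat) : @matrix R 1 (S (S m)) :=
  match m with
  | O => matA 3
  | S m' => @Mmult R_Ring 1 (S (S m')) (S (S (S m')))
              (prodA m') (matA (S (S (S (S m')))))
  end.

(* Meaningful for [n >= 3]. *)
Definition b_seq (n : nat) : R := coeff_mat 0 (prodA (n - 3)) 0 0.

(* Main.v *)
(* Let [f x = tan (x/2) - x/2]. Since [f' = (f + x/2)^2 / 2], the coefficients
   of the powers of [f] satisfy
     [(f^k)' = k/2 * (f^(k+1) + x f^k + x^2/4 f^(k-1))],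
   and this recurrence is the one that defines the row vectors
   [v^n = A^(3) ... A^(n)]:
     [v^n_(2k-1) = k! (2n+1-k)! 2^(1-k) [x^(2n-k)] f^k],
     [v^n_(2k) = (k+1)! (2n-k)! 2^(-k-2) [x^(2n-2-k)] f^k],
   the sums over [i >= j-1] being telescopic. Hence [b_n] is [(2n)!] times the
   coefficient of [x^(2n-1)] in [tan (x/2)].

   For the zeta values, put [S_n = int_0^(pi/2) cos (a x) cos^n x dx] and
   [W_n = - dS_n/da]. Integrating by parts twice,
   [W_n / S_n = W_(n+2) / S_(n+2) + 2 a / ((n+2)^2 - a^2)]; as [W_n / S_n -> 0],
   summing over even [n] gives the partial fractions of [cot], thus of
   [tan y = cot y - 2 cot (2 y)], with coefficients given by [zeta (2n)].

   The Bernoulli numbers come from [tanh (x/2) = 1 - 2 beta(x)/x + 2 beta(2x)/x]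
   with [beta(x) = x / (e^x - 1)], by comparing the Riccati equations of [tanh]
   and [tan]. *)

Require Import Defs.
From Stdlib Require Import Reals Arith.
From Coquelicot Require Import Coquelicot.
From Stdlib Require Import Lra Lia.

Open Scope R_scope.

(** * The row vectors *)

Lemma sum_f_R0_zero (u : nat -> R) (n : nat) :
  (forall k, (k <= n)%nat -> u k = 0) -> sum_f_R0 u n = 0.
Proof.
  induction n as [|n IH]; intros Hu.
  - simpl. now apply Hu.
  - rewrite tech5, IH, Hu by (intros; try apply Hu; lia). ring.
Qed.

Lemma sum_f_R0_zero_tail (u : nat -> R) (m n : nat) : (m <= n)%nat ->
  (forall k, (m < k)%nat -> u k = 0) -> sum_f_R0 u n = sum_f_R0 u m.
Proof.
  intros Hmn Hu. induction Hmn as [|n Hmn IH]; [reflexivity|].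
  rewrite tech5, IH, (Hu (S n)) by lia. ring.
Qed.

(* The array [phi k m] stands for the coefficient of [x^m] in [f^k],
   [f x = tan (x/2) - x/2]; the recurrence is
   [(f^k)' = k/2 * (f^(k+1) + x f^k + x^2/4 f^(k-1))]. *)
Definition power_array (phi : nat -> nat -> R) : Prop :=
  phi 0%nat 0%nat = 1 /\
  (forall m, phi 0%nat (S m) = 0) /\
  (forall k, phi (S k) 0%nat = 0) /\
  (forall k, phi (S k) 1%nat = / 2 * (INR (S k) * phi (S (S k)) 0%nat)) /\
  (forall k, 2 * phi (S k) 2%nat =
     / 2 * (INR (S k) * (phi (S (S k)) 1%nat + phi (S k) 0%nat))) /\
  (forall k m, INR (m + 3) * phi (S k) (m + 3)%nat =
     INR (S k) / 2 *
     (phi (S (S k)) (m + 2)%nat + phi (S k) (m + 1)%nat + phi k m / 4)).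

(** Since [f = O(x^3)], the power [f^k] vanishes to order [3k]. The recurrence alone shows it, by
    strong induction on the exponent: its right-hand side has smaller exponents, still below the
    respective orders. *)
Lemma power_array_low (phi : nat -> nat -> R) : power_array phi ->
  forall m k, (m < 3 * k)%nat -> phi k m = 0.
Proof.
  intros (H00 & H0 & Hk0 & Hk1 & Hk2 & Hrec) m.
  induction m as [m IH] using lt_wf_ind; intros k Hk.
  destruct k as [|k]; [lia|].
  destruct m as [|[|[|m]]].
  - apply Hk0.
  - rewrite Hk1, (IH 0%nat) by lia. ring.
  - specialize (Hk2 k). rewrite (IH 1%nat), (IH 0%nat) in Hk2 by lia. lra.
  - specialize (Hrec k m).
    rewrite (IH (m + 2)%nat), (IH (m + 1)%nat), (IH m) in Hrec by lia.
    replace (S (S (S m))) with (m + 3)%nat by lia.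
    apply (Rmult_eq_reg_l (INR (m + 3))); [rewrite Hrec; field|].
    apply not_0_INR; lia.
Qed.

Definition row_even (phi : nat -> nat -> R) (n k : nat) : R :=
  INR (fact (S k)) * INR (fact (2 * n - k)) / 2 ^ (k + 2) * phi k (2 * n - 2 - k)%nat.

(** The component of index [2k+1]: the formula for odd components taken at [k+1]. *)
Definition row_odd (phi : nat -> nat -> R) (n k : nat) : R :=
  INR (fact (S k)) * INR (fact (2 * n - k)) / 2 ^ k * phi (S k) (2 * n - 1 - k)%nat.

(* The [i]-th component of the row vector [A^(3) ... A^(n)], with [i] starting at 1. *)
Definition row (phi : nat -> nat -> R) (n i : nat) : R :=
  if Nat.even i then row_even phi n (Nat.div2 i) else row_odd phi n (Nat.div2 i).

Lemma row_2k phi n k : row phi n (2 * k) = row_even phi n k.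
Proof. unfold row. rewrite Nat.even_even, Nat.div2_double. reflexivity. Qed.

Lemma row_2k1 phi n k : row phi n (S (2 * k)) = row_odd phi n k.
Proof.
  unfold row. rewrite Nat.div2_succ_double.
  replace (S (2 * k)) with (2 * k + 1)%nat by lia. now rewrite Nat.even_odd.
Qed.

(** Closed form to which the sum of the components of index [i >= 2k] of the row [n-1]
    telescopes. *)
Definition row_tail (phi : nat -> nat -> R) (n k : nat) : R :=
  INR (fact k) * INR (fact (2 * n - 1 - k)) * 2 / 2 ^ k * phi (S k) (2 * n - 1 - k)%nat.

Lemma INR_fact_S (n : nat) : INR (fact (S n)) = INR (S n) * INR (fact n).
Proof. now rewrite fact_simpl, mult_INR. Qed.

Lemma INR_fact_pos (n : nat) : 0 < INR (fact n).
Proof. apply lt_0_INR, lt_O_fact. Qed.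

(** The recurrence for [f^(k+1)] at the exponent [2n+1-k]: its left side gives the first tail, its
    [f^(k+2)] term the second, and the terms in [f^(k+1)] and [f^k] are the two components. *)
Lemma row_pair (phi : nat -> nat -> R) (n k : nat) : power_array phi ->
  (2 <= n)%nat -> (k <= n)%nat ->
  row_even phi n k + row_odd phi n k = row_tail phi (S n) k - row_tail phi (S n) (S k).
Proof.
  intros (_ & _ & _ & _ & _ & Hrec) Hn Hk.
  unfold row_even, row_odd, row_tail.
  destruct (Nat.le_exists_sub (k + 2) (2 * n)) as (m & Hm & _); [lia|].
  replace (2 * n - k)%nat with (m + 2)%nat by lia.
  replace (2 * n - 2 - k)%nat with m by lia.
  replace (2 * n - 1 - k)%nat with (m + 1)%nat by lia.
  replace (2 * S n - 1 - k)%nat with (m + 3)%nat by lia.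
  replace (2 * S n - 1 - S k)%nat with (m + 2)%nat by lia.
  specialize (Hrec k m).
  replace (fact (m + 3)) with (fact (S (m + 2))) by (f_equal; lia).
  rewrite !INR_fact_S.
  replace (S (m + 2)) with (m + 3)%nat by lia.
  rewrite pow_add. simpl (2 ^ 2). simpl (2 ^ S k).
  assert (0 < 2 ^ k) by (apply pow_lt; lra).
  transitivity (INR (fact k) * INR (fact (m + 2)) * 2 / 2 ^ k *
    (INR (S k) / 2 *
     (phi (S (S k)) (m + 2)%nat + phi (S k) (m + 1)%nat + phi k m / 4)
     - INR (S k) / 2 * phi (S (S k)) (m + 2)%nat)).
  - field. lra.
  - rewrite <- Hrec. field. lra.
Qed.

(** For [i >= n] the exponent falls below the vanishing order of the power of [f]. So the row stops
    at index [n-1], the number of columns of [A^(n)]. *)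
Lemma row_low (phi : nat -> nat -> R) (n i : nat) : power_array phi ->
  (2 <= n)%nat -> (n <= i)%nat -> row phi n i = 0.
Proof.
  intros Hphi Hn Hi.
  destruct (Nat.Even_or_Odd i) as [[k ->]|[k ->]].
  - rewrite row_2k. unfold row_even.
    rewrite (power_array_low phi Hphi) by lia. ring.
  - rewrite Nat.add_1_r, row_2k1. unfold row_odd.
    rewrite (power_array_low phi Hphi) by lia. ring.
Qed.

Definition from_index (u : nat -> R) (k i : nat) : R :=
  if (k <=? i)%nat then u i else 0.

Lemma row_sum_pairs (phi : nat -> nat -> R) (n k K : nat) : power_array phi ->
  (2 <= n)%nat -> (k <= S K)%nat -> (K <= n)%nat ->
  sum_f_R0 (from_index (row phi n) (2 * k)) (S (2 * K)) =
  row_tail phi (S n) k - row_tail phi (S n) (S K).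
Proof.
  intros Hphi Hn. induction K as [|K IH]; intros Hk HK.
  - change (2 * 0)%nat with 0%nat. rewrite tech5; simpl (sum_f_R0 _ 0). unfold from_index.
    destruct k as [|[|k]]; [| |lia].
    + rewrite !(proj2 (Nat.leb_le _ _)) by lia.
      change 1%nat with (S (2 * 0)) at 1. rewrite row_2k1.
      change 0%nat with (2 * 0)%nat at 1. rewrite row_2k.
      rewrite row_pair by (auto; lia). reflexivity.
    + rewrite !(proj2 (Nat.leb_gt _ _)) by lia. ring.
  (* For [k = K+2] the range of summation is empty and the two tails coincide. *)
  - destruct (Nat.eq_dec k (S (S K))) as [->|Hne].
    + rewrite sum_f_R0_zero; [ring|].
      intros i Hi. unfold from_index. now rewrite (proj2 (Nat.leb_gt _ _)) by lia.
    + replace (2 * S K)%nat with (S (S (2 * K))) by lia.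
      do 2 rewrite tech5. rewrite IH by lia.
      unfold from_index. rewrite !(proj2 (Nat.leb_le _ _)) by lia.
      replace (S (S (2 * K))) with (2 * S K)%nat by lia.
      rewrite row_2k, row_2k1.
      pose proof (row_pair phi n (S K) Hphi Hn HK). lra.
Qed.

Lemma row_sum (phi : nat -> nat -> R) (m k : nat) : power_array phi ->
  (2 * k <= m + 3)%nat ->
  sum_f_R0 (fun l => from_index (row phi (m + 2)) (2 * k) (S l)) m =
  row_tail phi (m + 3) k.
Proof.
  intros Hphi Hk.
  pose proof (row_sum_pairs phi (m + 2) k (m + 2) Hphi ltac:(lia) ltac:(lia) ltac:(lia)) as H.
  replace (S (m + 2)) with (m + 3)%nat in H by lia.
  (* Components above index [m+1] vanish. Index 0, absent from the matrices, is split off; it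
     contributes 0 because [f^0 = 1] has no term of positive degree. *)
  rewrite (sum_f_R0_zero_tail _ (S m)), decomp_sum in H; simpl (pred _) in H.
  - replace (from_index (row phi (m + 2)) (2 * k) 0) with 0 in H.
    2:{ unfold from_index. destruct (2 * k <=? 0)%nat; [|reflexivity].
        change 0%nat with (2 * 0)%nat at 2. rewrite row_2k. unfold row_even.
        destruct Hphi as (_ & H0 & _).
        replace (2 * (m + 2) - 2 - 0)%nat with (S (2 * m + 1)) by lia.
        rewrite H0. ring. }
    replace (row_tail phi (m + 3) (m + 3)) with 0 in H.
    2:{ unfold row_tail. rewrite (power_array_low phi Hphi) by lia. ring. }
    rewrite Rplus_0_l, Rminus_0_r in H. exact H.
  - lia.
  - lia.
  - intros i Hi. unfold from_index. destruct (2 * k <=? i)%nat; [|reflexivity].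
    apply row_low; auto; lia.
Qed.

(** This is [v^n = v^(n-1) A^(n)] for [n = m+3]. An odd column is constant from row [j-1] on, which
    gives a tail sum; an even column has a single nonzero entry. *)
Lemma row_step (phi : nat -> nat -> R) (m j : nat) : power_array phi ->
  (1 <= j <= m + 2)%nat ->
  sum_f_R0 (fun l => row phi (m + 2) (S l) * a_entry (m + 3) (S l) j) m =
  row phi (m + 3) j.
Proof.
  intros Hphi Hj.
  destruct (Nat.Even_or_Odd j) as [[k ->]|[k ->]].
  - destruct k as [|k]; [lia|].
    rewrite row_2k.
    (* For [j = 2k+2] the only entry, at [i = 2k+1], equals [(k+2)(2n-k-1)/8]. *)
    transitivity (row_odd phi (m + 2) k * (INR (S k + 1) * INR (2 * (m + 3) - S k) / 8)).
    + rewrite (sum_eq _ (fun l => if (l =? 2 * k)%nat then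
        row_odd phi (m + 2) k * (INR (S k + 1) * INR (2 * (m + 3) - S k) / 8) else 0)).
      2:{ intros l _. unfold a_entry.
          rewrite <- Nat.negb_even, Nat.even_even. cbn [negb andb].
          replace (S l =? 2 * S k - 1)%nat with (l =? 2 * k)%nat.
          2:{ destruct (Nat.eqb_spec l (2 * k)); symmetry;
              [apply Nat.eqb_eq|apply Nat.eqb_neq]; lia. }
          destruct (Nat.eqb_spec l (2 * k)) as [->|]; [|ring].
          rewrite row_2k1, minus_INR, !plus_INR, !mult_INR, plus_INR by lia.
          simpl (INR 2); simpl (INR 1). simpl (INR 3). field. }
      rewrite (sum_f_R0_zero_tail _ (2 * k)) by
        (try lia; intros i Hi; now rewrite (proj2 (Nat.eqb_neq _ _)) by lia).
      destruct k as [|k]; [reflexivity|].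
      replace (2 * S k)%nat with (S (S (2 * k))) by lia.
      rewrite tech5, Nat.eqb_refl, sum_f_R0_zero; [ring|].
      intros i Hi. now rewrite (proj2 (Nat.eqb_neq _ _)) by lia.
    + unfold row_odd, row_even.
      replace (2 * (m + 2) - k)%nat with (2 * m + 4 - k)%nat by lia.
      replace (2 * (m + 3) - S k)%nat with (S (2 * m + 4 - k)) by lia.
      replace (2 * (m + 3) - 2 - S k)%nat with (2 * (m + 2) - 1 - k)%nat by lia.
      rewrite !INR_fact_S.
      replace (S k + 1)%nat with (S (S k)) by lia.
      replace (S k + 2)%nat with (S (S (S k))) by lia. simpl (2 ^ S _).
      assert (0 < 2 ^ k) by (apply pow_lt; lra).
      field. lra.
  - rewrite Nat.add_1_r, row_2k1.
    (* For [j = 2k+1] the constant entry is [(k+1)(2n-k)/2]. *)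
    rewrite (sum_eq _ (fun l => from_index (row phi (m + 2)) (2 * k) (S l) *
       (INR (S k) * INR (2 * (m + 3) - k) / 2))).
    2:{ intros l _. unfold a_entry, from_index.
        replace (Nat.odd (S (2 * k))) with true
          by (now rewrite <- Nat.add_1_r, Nat.odd_odd).
        rewrite <- Nat.negb_odd.
        replace (Nat.odd (S (2 * k))) with true
          by (now rewrite <- Nat.add_1_r, Nat.odd_odd).
        cbn [negb andb]. replace (S (2 * k) - 1)%nat with (2 * k)%nat by lia.
        destruct (2 * k <=? S l)%nat; [|ring].
        rewrite minus_INR, !S_INR, !mult_INR, !plus_INR by lia.
        simpl (INR 2). simpl (INR 3). field. }
    rewrite <- scal_sum, row_sum by (auto; lia).
    unfold row_tail, row_odd.
    replace (2 * (m + 3) - 1 - k)%nat with (2 * m + 5 - k)%nat by lia.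
    replace (2 * (m + 3) - k)%nat with (S (2 * m + 5 - k)) by lia.
    rewrite !INR_fact_S.
    assert (0 < 2 ^ k) by (apply pow_lt; lra).
    field. lra.
Qed.

(** * The product of the matrices *)

Lemma coeff_matA (n i j : nat) : (i < n - 2)%nat -> (j < n - 1)%nat ->
  coeff_mat 0 (matA n) i j = a_entry n (S i) (S j).
Proof. intros Hi Hj. unfold matA. now rewrite coeff_mat_bij. Qed.

Lemma coeff_prodA (phi : nat -> nat -> R) (m j : nat) : power_array phi ->
  (j < m + 2)%nat ->
  coeff_mat 0 (prodA m) 0 j = row phi (m + 3) (S j).
Proof.
  intros Hphi. revert j. induction m as [|m IH]; intros j Hj.
  - rewrite <- (row_step phi 0 (S j)) by (auto; lia).
    transitivity (a_entry 3 1 (S j)); [apply (coeff_matA 3 0 j); lia|].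
    simpl (sum_f_R0 _ 0).
    (* The induction starts from the empty product: [v^2] has the single component [1! 4! [x^3] f =
       24/24 = 1]. *)
    replace (row phi 2 1) with 1.
    { now rewrite Rmult_1_l. }
    change 1%nat with (S (2 * 0)). rewrite row_2k1. unfold row_odd.
    destruct Hphi as (H00 & H0 & Hk0 & Hk1 & Hk2 & Hrec).
    pose proof (Hrec 0%nat 0%nat) as H. simpl in H.
    pose proof (Hk2 1%nat) as H2. pose proof (Hk1 2%nat) as H31.
    rewrite Hk0 in H31. rewrite H31, Hk0 in H2.
    pose proof (Hk1 0%nat) as H11. rewrite Hk0 in H11.
    rewrite H00, H11 in H. simpl. simpl in H2. lra.
  - simpl prodA.
    unfold Mmult. rewrite coeff_mat_bij by lia.
    rewrite <- (row_step phi (S m) (S j)) by (auto; lia).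
    simpl pred.
    rewrite sum_n_Reals. apply sum_eq. intros l Hl.
    change (@zero (Ring.AbelianMonoid R_Ring)) with 0.
    change (@zero _) with 0.
    replace (S m + 2)%nat with (m + 3)%nat by lia.
    rewrite <- IH by lia.
    replace (S m + 3)%nat with (S (S (S (S m)))) by lia.
    rewrite <- coeff_matA by lia.
    reflexivity.
Qed.

Lemma b_seq_eq (phi : nat -> nat -> R) (n : nat) : power_array phi ->
  (3 <= n)%nat -> b_seq n = INR (fact (2 * n)) * phi 1%nat (2 * n - 1)%nat.
Proof.
  intros Hphi Hn. unfold b_seq.
  rewrite (coeff_prodA phi) by (auto; lia).
  replace (n - 3 + 3)%nat with n by lia.
  change 1%nat with (S (2 * 0)) at 1. rewrite row_2k1. unfold row_odd.
  rewrite !Nat.sub_0_r. simpl (fact 1). simpl (2 ^ 0). simpl (INR 1). field.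
Qed.

(** * Power series expansions to the right of 0 *)

(* Only positive points are asked for, since the identities for
   [z / (e^z - 1)] and [cot] are singular at [0]; this still determines [a]. *)
Definition expands (a : nat -> R) (f : R -> R) : Prop :=
  exists r : R, 0 < r /\ forall x, 0 < x < r -> is_pseries a x (f x).

Lemma is_pseries_radius (a : nat -> R) (x l : R) :
  is_pseries a x l -> Rbar_le (Rabs x) (CV_radius a).
Proof.
  intros Hl. apply Rbar_not_lt_le. intros Hlt.
  apply (CV_disk_outside a x Hlt).
  apply is_pseries_R in Hl. apply ex_series_lim_0. now exists l.
Qed.

(** Convergence at the single point [r/2] already bounds the radius of convergence from below, on
    both sides of 0. *)
Lemma expands_radius (a : nat -> R) (f : R -> R) : expands a f ->
  exists r, 0 < r /\ forall x, Rabs x < r -> Rbar_lt (Rabs x) (CV_radius a).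
Proof.
  intros (r & Hr & H). exists (r / 2). split; [lra|]. intros x Hx.
  apply Rbar_lt_le_trans with (Rabs (r / 2)).
  - simpl. rewrite (Rabs_pos_eq (r / 2)); lra.
  - apply (is_pseries_radius _ _ (f (r / 2))), H. lra.
Qed.

Lemma expands_radius_pos (a : nat -> R) (f : R -> R) : expands a f ->
  Rbar_lt 0 (CV_radius a).
Proof.
  intros H. destruct (expands_radius _ _ H) as (r & Hr & Hlt).
  rewrite <- Rabs_R0. apply Hlt. rewrite Rabs_R0. exact Hr.
Qed.

Lemma expands_ext (a b : nat -> R) (f g : R -> R) :
  (forall n, a n = b n) ->
  (exists r, 0 < r /\ forall x, 0 < x < r -> f x = g x) ->
  expands a f -> expands b g.
Proof.
  intros Hab (s & Hs & Hfg) (r & Hr & H).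
  exists (Rmin r s). split; [now apply Rmin_glb_lt|].
  intros x Hx. assert (0 < x < r /\ 0 < x < s) as [Hxr Hxs].
  { pose proof (Rmin_l r s). pose proof (Rmin_r r s). lra. }
  rewrite <- Hfg by easy. apply (is_pseries_ext a); auto.
Qed.

Lemma expands_plus (a b : nat -> R) (f g : R -> R) :
  expands a f -> expands b g ->
  expands (fun n => a n + b n) (fun x => f x + g x).
Proof.
  intros (r & Hr & Hf) (s & Hs & Hg).
  exists (Rmin r s). split; [now apply Rmin_glb_lt|].
  intros x Hx. pose proof (Rmin_l r s). pose proof (Rmin_r r s).
  apply (is_pseries_plus a b x (f x) (g x)); [apply Hf|apply Hg]; lra.
Qed.

Lemma expands_scal (c : R) (a : nat -> R) (f : R -> R) :
  expands a f -> expands (fun n => c * a n) (fun x => c * f x).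
Proof.
  intros (r & Hr & Hf). exists r. split; [easy|]. intros x Hx.
  apply (is_pseries_scal c a x (f x)); [apply Rmult_comm|now apply Hf].
Qed.

Lemma expands_mult (a b : nat -> R) (f g : R -> R) :
  expands a f -> expands b g -> expands (PS_mult a b) (fun x => f x * g x).
Proof.
  intros Ha Hb.
  destruct (expands_radius _ _ Ha) as (r & Hr & Hra).
  destruct (expands_radius _ _ Hb) as (s & Hs & Hsb).
  destruct Ha as (r' & Hr' & Hf). destruct Hb as (s' & Hs' & Hg).
  exists (Rmin (Rmin r s) (Rmin r' s')).
  split; [now repeat apply Rmin_glb_lt|]. intros x [Hx0 Hx].
  apply Rmin_Rgt in Hx as [Hx Hx']. apply Rmin_Rgt in Hx, Hx'.
  apply is_pseries_mult; [apply Hf|apply Hg|apply Hra|apply Hsb];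
    rewrite ?Rabs_pos_eq; lra.
Qed.

Lemma expands_incr (a : nat -> R) (f : R -> R) :
  expands a f -> expands (PS_incr_1 a) (fun x => x * f x).
Proof.
  intros (r & Hr & Hf). exists r. split; [easy|]. intros x Hx.
  apply (is_pseries_incr_1 a x (f x)). now apply Hf.
Qed.

Lemma expands_decr (a : nat -> R) (f : R -> R) :
  expands a f -> expands (PS_decr_1 a) (fun x => (f x - a 0%nat) / x).
Proof.
  intros (r & Hr & Hf). exists r. split; [easy|]. intros x Hx.
  replace ((f x - a 0%nat) / x) with (scal (/ x) (plus (f x) (opp (a 0%nat)))).
  - apply (is_pseries_decr_1 a x (/ x) (f x)); [|now apply Hf].
    apply Rinv_l. lra.
  - unfold scal, plus, opp; simpl. unfold mult; simpl. field. lra.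
Qed.

Lemma expands_dilate (c : R) (a : nat -> R) (f : R -> R) : 0 < c ->
  expands a f -> expands (fun n => a n * c ^ n) (fun x => f (c * x)).
Proof.
  intros Hc (r & Hr & Hf). exists (r / c). split; [now apply Rdiv_lt_0_compat|].
  intros x Hx. apply is_pseries_R.
  apply (is_series_ext (fun n => a n * (c * x) ^ n)).
  - intros n. now rewrite Rpow_mult_distr, <- Rmult_assoc.
  - apply is_pseries_R, Hf. split; [apply Rmult_lt_0_compat; lra|].
    apply (Rmult_lt_reg_r (/ c)); [now apply Rinv_0_lt_compat|].
    replace (c * x * / c) with x by (field; lra). apply Hx.
Qed.

Lemma expands_const (c : R) :
  expands (fun n => if (n =? 0)%nat then c else 0) (fun _ => c).
Proof.
  exists 1. split; [lra|]. intros x _.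
  apply is_pseries_R. apply filterlim_ext with (fun _ : nat => c).
  - intros n. rewrite sum_n_Reals. induction n as [|n IH]; simpl in *; lra.
  - apply filterlim_const.
Qed.

(** Around a small positive point the function agrees with its power series on a whole
    neighbourhood, hence so do the derivatives. *)
Lemma expands_derive (a : nat -> R) (f f' : R -> R) :
  expands a f ->
  (exists r, 0 < r /\ forall x, 0 < x < r -> is_derive f x (f' x)) ->
  expands (PS_derive a) f'.
Proof.
  intros Ha (s & Hs & Hd).
  destruct (expands_radius _ _ Ha) as (r & Hr & Hra).
  destruct Ha as (r' & Hr' & Hf).
  exists (Rmin s (Rmin r r')). split; [now repeat apply Rmin_glb_lt|].
  intros x [Hx0 Hx]. apply Rmin_Rgt in Hx as [Hxs Hx]. apply Rmin_Rgt in Hx as [Hxr Hxr'].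
  assert (Hcv : Rbar_lt (Rabs x) (CV_radius a)) by (apply Hra; rewrite Rabs_pos_eq; lra).
  replace (f' x) with (Derive (PSeries a) x); [now apply is_pseries_derive|].
  rewrite <- (is_derive_unique f x (f' x)) by (apply Hd; lra).
  apply Derive_ext_loc.
  assert (Hd0 : 0 < Rmin x (r' - x)) by (apply Rmin_glb_lt; lra).
  exists (mkposreal _ Hd0). intros y Hy.
  apply is_pseries_unique, Hf.
  pose proof (Rmin_l x (r' - x)). pose proof (Rmin_r x (r' - x)).
  unfold ball in Hy; simpl in Hy. unfold AbsRing_ball, abs, minus, plus, opp in Hy; simpl in Hy.
  apply Rabs_def2 in Hy. lra.
Qed.

(** The series minus [f] is continuous at 0 and vanishes just to the right of 0, so its value
    [a 0 - f 0] is 0. *)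
Lemma expands_head (a : nat -> R) (f : R -> R) :
  expands a f -> continuity_pt f 0 -> a 0%nat = f 0.
Proof.
  intros Ha Hf0.
  assert (Hc : continuity_pt (PSeries a - f)%F 0).
  { apply continuity_pt_minus; [|easy]. apply PSeries_continuity.
    rewrite Rabs_R0. exact (expands_radius_pos _ _ Ha). }
  destruct Ha as (r & Hr & Hf).
  destruct (Req_dec (a 0%nat) (f 0)) as [|Hne]; [easy|exfalso].
  (* With this number as epsilon, the point [min(d,r)/2] yields epsilon < epsilon. *)
  destruct (Hc (Rabs (a 0%nat - f 0))) as (d & Hd & Hlt); [apply Rabs_pos_lt; lra|].
  assert (Hm : 0 < Rmin d r) by now apply Rmin_glb_lt.
  pose proof (Rmin_l d r). pose proof (Rmin_r d r).
  specialize (Hlt (Rmin d r / 2)).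
  simpl in Hlt. unfold Rdist, minus_fct in Hlt.
  rewrite PSeries_0, (is_pseries_unique _ _ (f (Rmin d r / 2))) in Hlt by (apply Hf; lra).
  replace (f (Rmin d r / 2) - f (Rmin d r / 2) - (a 0%nat - f 0))
    with (- (a 0%nat - f 0)) in Hlt by ring.
  rewrite Rabs_Ropp in Hlt.
  apply (Rlt_irrefl (Rabs (a 0%nat - f 0))), Hlt.
  repeat split; [lra|]. rewrite Rminus_0_r, Rabs_pos_eq; lra.
Qed.

(** The constant term is 0 by continuity; dividing by [x] shifts the coefficients and again
    represents the zero function. *)
Lemma expands_zero (n : nat) : forall a : nat -> R, expands a (fun _ => 0) -> a n = 0.
Proof.
  induction n as [|n IH]; intros a Ha;
    pose proof (expands_head a _ Ha (continuity_pt_const (fun _ => 0) 0 (fun _ _ => eq_refl))) as H0;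
    [easy|].
  apply (IH (PS_decr_1 a)).
  apply (expands_ext (PS_decr_1 a) _ (fun x => (0 - a 0%nat) / x)); [easy| |].
  - exists 1. split; [lra|]. intros x Hx. rewrite H0. field. lra.
  - now apply (expands_decr a (fun _ => 0)).
Qed.

Lemma expands_unique (a b : nat -> R) (f : R -> R) :
  expands a f -> expands b f -> forall n, a n = b n.
Proof.
  intros Ha Hb n. apply Rminus_diag_uniq.
  apply (expands_zero n (fun n => a n - b n)).
  apply (expands_ext (fun n => a n + -1 * b n) _ (fun x => f x + -1 * f x)).
  - intros k. ring.
  - exists 1. split; [lra|]. intros x _. ring.
  - apply expands_plus; [easy|]. now apply expands_scal.
Qed.

(* The coefficients of [tan (x/2) - x/2] when [q] are those of [tan (x/2)]. *)
Definition half_tan_tail (q : nat -> R) (n : nat) : R :=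
  q n + PS_incr_1 (fun n => if (n =? 0)%nat then - / 2 else 0) n.

(** * Powers of [tan (x/2) - x/2] *)

Fixpoint PS_pow (a : nat -> R) (k : nat) : nat -> R :=
  match k with
  | O => fun n => if (n =? 0)%nat then 1 else 0
  | S k => PS_mult a (PS_pow a k)
  end.

Lemma PS_pow_1 (a : nat -> R) (n : nat) : PS_pow a 1 n = a n.
Proof.
  change (PS_mult a (PS_pow a 0) n = a n). unfold PS_mult.
  destruct n as [|n]; [simpl; ring|].
  rewrite tech5, Nat.sub_diag, sum_f_R0_zero; [simpl; ring|].
  intros k Hk. cbn [PS_pow]. rewrite (proj2 (Nat.eqb_neq _ _)) by lia. ring.
Qed.

Lemma expands_pow (a : nat -> R) (f : R -> R) (k : nat) :
  expands a f -> expands (PS_pow a k) (fun x => f x ^ k).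
Proof.
  intros Ha. induction k as [|k IH]; [apply expands_const|].
  now apply expands_mult.
Qed.

Lemma cos_half_pos (x : R) : 0 < x < 1 -> 0 < cos (x / 2).
Proof. intros Hx. pose proof PI2_1. apply cos_gt_0; lra. Qed.

Lemma is_derive_half_tan (x : R) : 0 < x < 1 ->
  is_derive (fun x => tan (x / 2)) x (/ 2 * (1 + tan (x / 2) ^ 2)).
Proof.
  intros Hx. pose proof (cos_half_pos x Hx).
  replace (/ 2 * (1 + tan (x / 2) ^ 2)) with (scal (/ 2) (tan (x / 2) ^ 2 + 1))
    by (unfold scal; simpl; unfold mult; simpl; ring).
  apply (is_derive_comp tan (fun x => x / 2)).
  - apply is_derive_tan. lra.
  - auto_derive; [easy|]. field.
Qed.

Lemma half_tan_power_array (q : nat -> R) :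
  expands q (fun x => tan (x / 2)) -> power_array (PS_pow (half_tan_tail q)).
Proof.
  intros Hq.
  set (f := fun x => tan (x / 2) + x * - / 2).
  assert (Hf : expands (half_tan_tail q) f).
  { apply expands_plus; [easy|]. apply (expands_incr _ (fun _ => - / 2)), expands_const. }
  set (phi := PS_pow (half_tan_tail q)).
  assert (Hphi : forall k, expands (phi k) (fun x => f x ^ k))
    by (intros k; now apply expands_pow).
  (* Both sides are expansions of [(f^(k+1))'], by [f' = (f + x/2)^2 / 2]; uniqueness equates the
     coefficients. *)
  assert (Hrec : forall k n, PS_derive (phi (S k)) n =
    INR (S k) / 2 * (phi (S (S k)) n + (PS_incr_1 (phi (S k)) n +
      / 4 * PS_incr_1 (PS_incr_1 (phi k)) n))).
  { intros k. apply (expands_unique _ _ (fun x => INR (S k) / 2 *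
      (f x ^ (S (S k)) + (x * f x ^ (S k) + / 4 * (x * (x * f x ^ k)))))).
    - apply (expands_derive _ _ _ (Hphi (S k))).
      exists 1. split; [lra|]. intros x Hx.
      assert (Hd : is_derive f x (/ 2 * (f x + x / 2) ^ 2)).
      { replace (/ 2 * (f x + x / 2) ^ 2) with (/ 2 * (1 + tan (x / 2) ^ 2) + - / 2)
          by (unfold f; field).
        apply (is_derive_plus (fun x => tan (x / 2)) (fun x => x * - / 2));
          [now apply is_derive_half_tan|]. auto_derive; [easy|]. ring. }
      pose proof (is_derive_pow f (S k) x _ Hd) as Hp.
      replace (INR (S k) / 2 *
        (f x ^ S (S k) + (x * f x ^ S k + / 4 * (x * (x * f x ^ k)))))
        with (INR (S k) * (/ 2 * (f x + x / 2) ^ 2) * f x ^ pred (S k)); [exact Hp|].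
      simpl pred. simpl (f x ^ S _). field.
    - apply expands_scal, expands_plus; [apply Hphi|].
      apply expands_plus; [apply expands_incr, Hphi|].
      apply expands_scal. apply (expands_incr _ (fun x => x * f x ^ k)).
      apply expands_incr, Hphi. }
  assert (Hq0 : q 0%nat = 0).
  { rewrite (expands_head q _ Hq); [now rewrite Rdiv_0_l, tan_0|].
    apply continuity_pt_filterlim, (ex_derive_continuous (fun x => tan (x / 2))).
    exists (scal (/ 2) (tan (0 / 2) ^ 2 + 1)).
    apply (is_derive_comp tan (fun x => x / 2)).
    - apply is_derive_tan. rewrite Rdiv_0_l, cos_0. lra.
    - auto_derive; [easy|]. field. }
  (* The clauses on [f^0] hold by computation. The others are [q 0 = 0] and [Hrec] at 0, 1 and
     [m+2], the first two apart because multiplying by [x] and [x^2] shifts coefficients. *)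
  repeat split.
  - intros k. unfold phi. simpl. unfold PS_mult, half_tan_tail. simpl.
    unfold zero; simpl. rewrite Hq0. ring.
  - intros k. specialize (Hrec k 0%nat). unfold PS_derive in Hrec.
    cbn [PS_incr_1] in Hrec. change zero with 0 in Hrec.
    rewrite INR_1 in Hrec. rewrite <- (Rmult_1_l (phi (S k) 1%nat)), Hrec. field.
  - intros k. specialize (Hrec k 1%nat). unfold PS_derive in Hrec.
    cbn [PS_incr_1] in Hrec. change zero with 0 in Hrec.
    change (INR 2) with 2 in Hrec. rewrite Hrec. field.
  - intros k m. specialize (Hrec k (m + 2)%nat). unfold PS_derive in Hrec.
    replace (S (m + 2)) with (m + 3)%nat in Hrec by lia. rewrite Hrec.
    replace (m + 2)%nat with (S (S m)) by lia.
    replace (m + 1)%nat with (S m) by lia. simpl PS_incr_1. field.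
Qed.

(** * Bernoulli numbers and the hyperbolic tangent *)

(** Displays an equality in a structure whose carrier is convertible to [R] as one in [R], so that
    [ring] and [field] recognise it. *)
Ltac at_R := match goal with |- @eq _ ?a ?b => change (@eq R a b) end.

Lemma is_series_Re (u : nat -> C) (l : C) :
  @is_series C_AbsRing C_NormedModule u l -> is_series (fun n => Re (u n)) (Re l).
Proof.
  intros H. unfold is_series.
  apply filterlim_ext with (fun n => Re (@sum_n C_NormedModule u n)).
  - induction x as [|n IH]; [now rewrite !sum_O|].
    rewrite !sum_Sn, <- IH. reflexivity.
  - apply filterlim_comp with (1 := H).
    (* Balls of [C] are products of real balls, so the projection is continuous. *)
    intros P [eps HP]. exists eps. intros y Hy. apply HP, Hy.
Qed.

Lemma is_series_Im (u : nat -> C) (l : C) :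
  @is_series C_AbsRing C_NormedModule u l -> is_series (fun n => Im (u n)) (Im l).
Proof.
  intros H. unfold is_series.
  apply filterlim_ext with (fun n => Im (@sum_n C_NormedModule u n)).
  - induction x as [|n IH]; [now rewrite !sum_O|].
    rewrite !sum_Sn, <- IH. reflexivity.
  - apply filterlim_comp with (1 := H).
    intros P [eps HP]. exists eps. intros y Hy. apply HP, Hy.
Qed.

Lemma pow_n_RtoC (x : R) (n : nat) : pow_n (K := C_AbsRing) (RtoC x) n = RtoC (x ^ n).
Proof.
  induction n as [|n IH]; [reflexivity|].
  simpl pow_n. rewrite IH. simpl (x ^ S n). now rewrite RtoC_mult.
Qed.

(** At real [z = x] the generating function is real, so the real parts of [B] carry all of it and
    the imaginary parts expand 0. *)
Lemma bernoulli_series (B : nat -> C) : is_bernoulli B ->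
  expands (fun n => Re (B n) / INR (fact n)) (fun x => x / (exp x - 1)) /\
  expands (fun n => Im (B n) / INR (fact n)) (fun _ => 0).
Proof.
  intros HB.
  assert (H : forall x, 0 < x < 1 -> @is_series C_AbsRing C_NormedModule
     (fun n => (RtoC (x ^ n / INR (fact n)) * B n)%C) (RtoC (x / (exp x - 1)))).
  { intros x Hx.
    assert (He : exp x - 1 <> 0) by (pose proof (exp_ineq1 x); lra).
    replace (RtoC (x / (exp x - 1))) with (x / (Cexp x - 1))%C.
    - eapply is_series_ext; [|apply (HB (RtoC x))].
      + intros n. change (@eq C (pow_n (K := C_AbsRing) (RtoC x) n * (B n / INR (fact n)))%C
          (RtoC (x ^ n / INR (fact n)) * B n)%C).
        pose proof (INR_fact_lt_0 n).
        rewrite pow_n_RtoC, RtoC_div by lra. field.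
        intros E. apply RtoC_inj in E. lra.
      + intros E. apply RtoC_inj in E. lra.
      + rewrite Cmod_R, Rabs_pos_eq by lra. pose proof PI2_1. lra.
    - rewrite RtoC_div by easy. f_equal. unfold Cexp, RtoC. simpl.
      rewrite cos_0, sin_0. apply injective_projections; simpl; ring. }
  split; exists 1; (split; [lra|]); intros x Hx; apply is_pseries_R.
  - eapply is_series_ext; [|exact (is_series_Re _ _ (H x Hx))].
    intros n. cbv beta. rewrite re_scal_l. at_R. unfold Rdiv. ring.
  - eapply is_series_ext; [|exact (is_series_Im _ _ (H x Hx))].
    intros n. cbv beta. rewrite im_scal_l. at_R. unfold Rdiv. ring.
Qed.

Definition half_tanh_coef (beta : nat -> R) (n : nat) : R :=
  (if (n =? 0)%nat then 1 else 0) + 2 * (2 ^ S n - 1) * beta (S n).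

(** Coefficientwise form of [1 - 2 beta(x)/x + 2 beta(2x)/x]. The constant terms removed before
    dividing by [x] cancel between the two quotients. *)
Lemma expands_half_tanh (beta : nat -> R) :
  expands beta (fun x => x / (exp x - 1)) ->
  expands (half_tanh_coef beta) (fun x => (exp x - 1) / (exp x + 1)).
Proof.
  intros Hb.
  pose proof (expands_decr _ _ Hb) as H1.
  pose proof (expands_decr _ _ (expands_dilate 2 _ _ ltac:(lra) Hb)) as H2.
  apply (expands_ext _ _ _ _ ) with
    (3 := expands_plus _ _ _ _ (expands_const 1)
      (expands_plus _ _ _ _ (expands_scal (-2) _ _ H1) (expands_scal 2 _ _ H2))).
  - intros n. unfold half_tanh_coef, PS_decr_1. ring.
  - exists 1. split; [lra|]. intros x Hx.
    assert (He : 1 < exp x) by (pose proof (exp_ineq1 x); lra).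
    replace (exp (2 * x)) with (exp x * exp x) by (rewrite <- exp_plus; f_equal; ring).
    simpl. field. nra.
Qed.

(** The Riccati equation [T' = (1 - T^2)/2] with [T(0) = 0], for [T = tanh (x/2)]. *)
Lemma half_tanh_coef_rec (e : nat -> R) :
  expands e (fun x => (exp x - 1) / (exp x + 1)) ->
  e 0%nat = 0 /\
  forall n, INR (S n) * e (S n) = / 2 * ((if (n =? 0)%nat then 1 else 0) - PS_mult e e n).
Proof.
  intros He. split.
  - rewrite (expands_head _ _ He).
    + rewrite exp_0. field.
    + apply continuity_pt_filterlim,
        (ex_derive_continuous (fun x => (exp x - 1) / (exp x + 1))).
      auto_derive. pose proof (exp_pos 0). lra.
  - intros n. change (PS_derive e n = / 2 * ((if (n =? 0)%nat then 1 else 0) - PS_mult e e n)).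
    transitivity (/ 2 * ((if (n =? 0)%nat then 1 else 0) + -1 * PS_mult e e n)); [|ring].
    revert n. apply (expands_unique _ _ (fun x => / 2 * (1 + -1 *
      ((exp x - 1) / (exp x + 1) * ((exp x - 1) / (exp x + 1)))))).
    + apply (expands_derive _ _ _ He). exists 1. split; [lra|]. intros x _.
      pose proof (exp_pos x).
      auto_derive; [lra|]. field. lra.
    + apply expands_scal, expands_plus; [apply expands_const|].
      apply expands_scal. now apply expands_mult.
Qed.

(** The Riccati equation [t' = (1 + t^2)/2] for [t = tan (x/2)]. *)
Lemma half_tan_coef_rec (q : nat -> R) :
  expands q (fun x => tan (x / 2)) ->
  forall n, INR (S n) * q (S n) = / 2 * ((if (n =? 0)%nat then 1 else 0) + PS_mult q q n).
Proof.
  intros Hq n.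
  change (PS_derive q n = / 2 * ((if (n =? 0)%nat then 1 else 0) + PS_mult q q n)).
  revert n. apply (expands_unique _ _ (fun x => / 2 * (1 + tan (x / 2) * tan (x / 2)))).
  - apply (expands_derive _ _ _ Hq). exists 1. split; [lra|]. intros x Hx.
    replace (tan (x / 2) * tan (x / 2)) with (tan (x / 2) ^ 2) by ring.
    now apply is_derive_half_tan.
  - apply expands_scal, expands_plus; [apply expands_const|].
    now apply expands_mult.
Qed.

(* [tanh (x/2) = - i tan (i x/2)], so passing from [tan] to [tanh] multiplies
   the coefficient of [x^n], [n] odd, by [(-1)^((n-1)/2)]. *)
Lemma half_tanh_coef_eq (q e : nat -> R) :
  expands q (fun x => tan (x / 2)) ->
  (forall n, q (2 * n)%nat = 0) ->
  expands e (fun x => (exp x - 1) / (exp x + 1)) ->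
  forall n, e n = (-1) ^ (Nat.div2 n) * q n.
Proof.
  intros Hq Hq0 He.
  pose proof (half_tan_coef_rec q Hq) as Hqr.
  destruct (half_tanh_coef_rec e He) as [He0 Her].
  intros n. induction n as [n IH] using lt_wf_ind.
  destruct n as [|n].
  { rewrite He0. replace (q 0%nat) with 0 by (symmetry; apply (Hq0 0%nat)). ring. }
  apply (Rmult_eq_reg_l (INR (S n))); [|apply not_0_INR; lia].
  rewrite Her.
  transitivity ((-1) ^ Nat.div2 (S n) * (INR (S n) * q (S n))); [|ring].
  rewrite Hqr.
  (* Only terms with [i = 2a+1] and [n-i = 2b+1] survive. Their sign is [(-1)^(a+b)], while
     [n+1 = 2(a+b+1)+1]; the extra minus turns one Riccati equation into the other. *)
  assert (HP : PS_mult e e n = - (-1) ^ Nat.div2 (S n) * PS_mult q q n).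
  { unfold PS_mult. rewrite scal_sum. apply sum_eq. intros i Hi.
    rewrite !IH by lia.
    destruct (Nat.Even_or_Odd i) as [[a ->]|[a Ha]]; [rewrite Hq0; ring|].
    destruct (Nat.Even_or_Odd (n - i)) as [[b ->]|[b Hb]]; [rewrite Hq0; ring|].
    replace (Nat.div2 i) with a by
      (rewrite Ha, Nat.add_1_r; symmetry; apply Nat.div2_succ_double).
    replace (Nat.div2 (n - i)) with b by
      (rewrite Hb, Nat.add_1_r; symmetry; apply Nat.div2_succ_double).
    replace (S n) with (S (2 * (S (a + b)))) by lia.
    rewrite Nat.div2_succ_double. simpl ((-1) ^ S _). rewrite pow_add. ring. }
  rewrite HP. destruct (Nat.eqb_spec n 0) as [->|Hn]; simpl (Nat.div2 1).
  - simpl (_ ^ 0). ring.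
  - ring.
Qed.

(** * Partial fractions of the cotangent *)

Definition S_int (a : R) (n : nat) : R :=
  RInt (fun x => cos (a * x) * cos x ^ n) 0 (PI / 2).
Definition W_int (a : R) (n : nat) : R :=
  RInt (fun x => x * sin (a * x) * cos x ^ n) 0 (PI / 2).

Lemma ex_RInt_S (a : R) (n : nat) (u v : R) :
  ex_RInt (fun x => cos (a * x) * cos x ^ n) u v.
Proof.
  apply (ex_RInt_continuous (V := R_CompleteNormedModule)). intros x _.
  apply (ex_derive_continuous (fun x => cos (a * x) * cos x ^ n)). now auto_derive.
Qed.

Lemma ex_RInt_W (a : R) (n : nat) (u v : R) :
  ex_RInt (fun x => x * sin (a * x) * cos x ^ n) u v.
Proof.
  apply (ex_RInt_continuous (V := R_CompleteNormedModule)). intros x _.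
  apply (ex_derive_continuous (fun x => x * sin (a * x) * cos x ^ n)). now auto_derive.
Qed.

Lemma RInt_of_derive (F f : R -> R) (a b : R) :
  (forall x, is_derive F x (f x)) -> (forall x, ex_derive f x) ->
  is_RInt f a b (F b - F a).
Proof.
  intros HF Hf. apply (is_RInt_derive F f); intros x _; [apply HF|].
  now apply (ex_derive_continuous f).
Qed.

Lemma S_int_rec (a : R) (n : nat) :
  (INR (n + 2) ^ 2 - a ^ 2) * S_int a (n + 2) = INR (n + 2) * INR (n + 1) * S_int a n.
Proof.
  apply Rminus_diag_uniq. unfold S_int.
  set (f := fun m x => cos (a * x) * cos x ^ m).
  (* Boundary terms of the two integrations by parts: the sines kill [F] at 0, and [cos^(n+1)] kills
     it at [PI/2]. *)
  set (F := fun x => cos x ^ (n + 1) *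
    (INR (n + 2) * sin x * cos (a * x) - a * cos x * sin (a * x))).
  transitivity (F (PI / 2) - F 0).
  2:{ unfold F. rewrite cos_PI2, sin_0, Rmult_0_r, sin_0, Nat.add_1_r. simpl. ring. }
  assert (H : is_RInt (fun x => (INR (n + 2) ^ 2 - a ^ 2) * f (n + 2)%nat x -
    INR (n + 2) * INR (n + 1) * f n x) 0 (PI / 2) (F (PI / 2) - F 0)).
  { apply RInt_of_derive.
    - intros x. unfold F, f. auto_derive; [easy|].
      replace (pred (n + 1)) with n by lia.
      rewrite !plus_INR, !pow_add. change (INR 1) with 1. change (INR 2) with 2.
      assert (Hs : sin x * sin x = 1 - cos x * cos x)
        by (pose proof (sin2_cos2 x); unfold Rsqr in *; lra).
      ring_simplify.
      replace (sin x ^ 2) with (1 - cos x * cos x) by (rewrite <- Hs; ring). ring.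
    - intros x. unfold f. now auto_derive. }
  rewrite <- (is_RInt_unique _ _ _ _ H).
  symmetry. apply is_RInt_unique.
  apply (is_RInt_minus (fun x => (INR (n + 2) ^ 2 - a ^ 2) * f (n + 2)%nat x)
    (fun x => INR (n + 2) * INR (n + 1) * f n x)).
  - apply (is_RInt_scal (f (n + 2)%nat)), (RInt_correct (f (n + 2)%nat)), ex_RInt_S.
  - apply (is_RInt_scal (f n)), (RInt_correct (f n)), ex_RInt_S.
Qed.

(** This is [-d/da] of the recurrence for [S_int], and the primitive [F] is [-d/da] of the earlier
    one. *)
Lemma W_int_rec (a : R) (n : nat) :
  (INR (n + 2) ^ 2 - a ^ 2) * W_int a (n + 2) + 2 * a * S_int a (n + 2) =
  INR (n + 2) * INR (n + 1) * W_int a n.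
Proof.
  apply Rminus_diag_uniq. unfold S_int, W_int.
  set (f := fun m x => cos (a * x) * cos x ^ m).
  set (g := fun m x => x * sin (a * x) * cos x ^ m).
  set (F := fun x => cos x ^ (n + 1) * (INR (n + 2) * sin x * x * sin (a * x)
    + cos x * sin (a * x) + a * cos x * x * cos (a * x))).
  transitivity (F (PI / 2) - F 0).
  2:{ unfold F. rewrite cos_PI2, sin_0, Rmult_0_r, sin_0, Nat.add_1_r. simpl. ring. }
  assert (H : is_RInt (fun x => (INR (n + 2) ^ 2 - a ^ 2) * g (n + 2)%nat x +
    2 * a * f (n + 2)%nat x - INR (n + 2) * INR (n + 1) * g n x)
    0 (PI / 2) (F (PI / 2) - F 0)).
  { apply RInt_of_derive.
    - intros x. unfold F, f, g. auto_derive; [easy|].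
      replace (pred (n + 1)) with n by lia.
      rewrite !plus_INR, !pow_add. change (INR 1) with 1. change (INR 2) with 2.
      assert (Hs : sin x * sin x = 1 - cos x * cos x)
        by (pose proof (sin2_cos2 x); unfold Rsqr in *; lra).
      ring_simplify.
      replace (sin x ^ 2) with (1 - cos x * cos x) by (rewrite <- Hs; ring). ring.
    - intros x. unfold f, g. now auto_derive. }
  rewrite <- (is_RInt_unique _ _ _ _ H).
  symmetry. apply is_RInt_unique.
  apply (is_RInt_minus (fun x => (INR (n + 2) ^ 2 - a ^ 2) * g (n + 2)%nat x +
    2 * a * f (n + 2)%nat x) (fun x => INR (n + 2) * INR (n + 1) * g n x)).
  - apply (is_RInt_plus (fun x => (INR (n + 2) ^ 2 - a ^ 2) * g (n + 2)%nat x)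
      (fun x => 2 * a * f (n + 2)%nat x)).
    + apply (is_RInt_scal (g (n + 2)%nat)), (RInt_correct (g (n + 2)%nat)), ex_RInt_W.
    + apply (is_RInt_scal (f (n + 2)%nat)), (RInt_correct (f (n + 2)%nat)), ex_RInt_S.
  - apply (is_RInt_scal (g n)), (RInt_correct (g n)), ex_RInt_W.
Qed.

Lemma S_int_0 (a : R) : a <> 0 -> S_int a 0 = sin (a * (PI / 2)) / a.
Proof.
  intros Ha. apply is_RInt_unique.
  replace (sin (a * (PI / 2)) / a) with (sin (a * (PI / 2)) / a - sin (a * 0) / a)
    by (rewrite Rmult_0_r, sin_0; now field).
  apply (RInt_of_derive (fun x => sin (a * x) / a)).
  - intros x. auto_derive; [easy|]. field. easy.
  - intros x. now auto_derive.
Qed.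

Lemma W_int_0 (a : R) : a <> 0 ->
  W_int a 0 = sin (a * (PI / 2)) / a ^ 2 - PI / 2 * cos (a * (PI / 2)) / a.
Proof.
  intros Ha. apply is_RInt_unique.
  set (F := fun x => sin (a * x) / a ^ 2 - x * cos (a * x) / a).
  replace (sin (a * (PI / 2)) / a ^ 2 - PI / 2 * cos (a * (PI / 2)) / a)
    with (F (PI / 2) - F 0) by (unfold F; rewrite Rmult_0_r, sin_0; now field).
  apply RInt_of_derive.
  - intros x. unfold F. auto_derive; [easy|]. field. easy.
  - intros x. now auto_derive.
Qed.

Lemma S_int_pos (a : R) (n : nat) : 0 < a < 1 -> 0 < S_int a n.
Proof.
  intros Ha. pose proof PI_RGT_0. apply RInt_gt_0; [lra| |].
  - intros x Hx. apply Rmult_lt_0_compat; [|apply pow_lt]; apply cos_gt_0; nra.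
  - intros x _. apply (ex_derive_continuous (fun x => cos (a * x) * cos x ^ n)).
    now auto_derive.
Qed.

Lemma W_int_nonneg (a : R) (n : nat) : 0 < a < 1 -> 0 <= W_int a n.
Proof.
  intros Ha. pose proof PI_RGT_0. apply RInt_ge_0; [lra|apply ex_RInt_W|].
  intros x Hx. apply Rmult_le_pos; [|apply pow_le, cos_ge_0; lra].
  apply Rmult_le_pos; [lra|]. apply sin_ge_0; nra.
Qed.

(** The function [sin x - x cos x] is 0 at 0 and has derivative [x sin x >= 0]. *)
Lemma x_cos_le_sin (x : R) : 0 <= x <= PI / 2 -> x * cos x <= sin x.
Proof.
  intros Hx.
  destruct (Req_dec x 0) as [->|Hx0]; [rewrite sin_0; lra|].
  destruct (MVT_gen (fun x => sin x - x * cos x) 0 x (fun x => x * sin x))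
    as (c & Hc & HE).
  - intros y _. auto_derive; [easy|]. ring.
  - intros y _. apply continuity_pt_filterlim.
    apply (ex_derive_continuous (fun x => sin x - x * cos x)). now auto_derive.
  - rewrite Rmin_left, Rmax_right in Hc by lra.
    rewrite sin_0 in HE.
    assert (0 <= sin c) by (apply sin_ge_0; lra).
    assert (0 <= c * sin c * (x - 0)) by (repeat apply Rmult_le_pos; lra).
    lra.
Qed.

(** Pointwise, [x sin(ax) cos^(n+1) x <= sin^2 x cos^n x] and [cos^(n+2) x <= cos(ax) cos^(n+1) x].
    The two bounds are linked by integrating the derivative of [sin x cos^(n+1) x]. Hence [W/S]
    tends to 0. *)
Lemma W_int_le (a : R) (n : nat) : 0 < a < 1 ->
  INR (S n) * W_int a (S n) <= S_int a (S n).
Proof.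
  intros Ha. pose proof PI_RGT_0.
  assert (HF : is_RInt (fun x => cos x * cos x ^ S n - INR (S n) * (sin x * sin x * cos x ^ n))
     0 (PI / 2) 0).
  { set (F := fun x => sin x * cos x ^ S n).
    replace 0 with (F (PI / 2) - F 0) at 2
      by (unfold F; rewrite cos_PI2, sin_0; simpl; ring).
    apply RInt_of_derive.
    - intros x. unfold F. auto_derive; [easy|]. change (pred (S n)) with n. rewrite <- tech_pow_Rmult.
      change (match n with 0%nat => 1 | S _ => INR n + 1 end) with (INR (S n)). ring.
    - intros x. now auto_derive. }
  assert (HG : is_RInt (fun x => cos (a * x) * cos x ^ S n -
      INR (S n) * (x * sin (a * x) * cos x ^ S n)) 0 (PI / 2)
      (S_int a (S n) - INR (S n) * W_int a (S n))).
  { apply (is_RInt_minus (fun x => cos (a * x) * cos x ^ S n)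
      (fun x => INR (S n) * (x * sin (a * x) * cos x ^ S n))).
    - apply (RInt_correct (fun x => cos (a * x) * cos x ^ S n)), ex_RInt_S.
    - apply (is_RInt_scal (fun x => x * sin (a * x) * cos x ^ S n)),
        (RInt_correct (fun x => x * sin (a * x) * cos x ^ S n)), ex_RInt_W. }
  enough (0 <= S_int a (S n) - INR (S n) * W_int a (S n)) by lra.
  apply (is_RInt_le _ _ 0 (PI / 2) _ _ ltac:(lra) HF HG).
  intros x Hx.
  assert (Hc : 0 <= cos x) by (apply cos_ge_0; lra).
  assert (Hs : 0 <= sin x) by (apply sin_ge_0; lra).
  assert (Hca : cos x <= cos (a * x)) by (apply cos_decr_1; nra).
  assert (Hsa : sin (a * x) <= sin x) by (apply sin_incr_1; nra).
  assert (Hsa0 : 0 <= sin (a * x)) by (apply sin_ge_0; nra).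
  pose proof (x_cos_le_sin x ltac:(lra)) as Hxc.
  apply Rplus_le_compat.
  - apply Rmult_le_compat_r; [now apply pow_le|easy].
  - apply Ropp_le_contravar, Rmult_le_compat_l; [apply pos_INR|].
    replace (x * sin (a * x) * cos x ^ S n) with (sin (a * x) * (x * cos x) * cos x ^ n)
      by (simpl; ring).
    apply Rmult_le_compat_r; [now apply pow_le|].
    apply Rmult_le_compat; try easy. apply Rmult_le_pos; lra.
Qed.

(** The positive poles of [cot (a PI/2)] as a function of [a]. *)
Definition pole (k : nat) : R := 2 * INR (S k).

Lemma pole_ge_2 (k : nat) : 2 <= pole k.
Proof. unfold pole. rewrite S_INR. pose proof (pos_INR k). lra. Qed.

Lemma cot_partial_sum (a : R) (k : nat) : 0 < a < 1 ->
  sum_f_R0 (fun i => 2 * a / (pole i ^ 2 - a ^ 2)) k =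
  1 / a - PI / 2 * cos (a * (PI / 2)) / sin (a * (PI / 2))
  - W_int a (2 * k + 2) / S_int a (2 * k + 2).
Proof.
  intros Ha.
  (* Quotient of the recurrences for [W_int] and [S_int]. *)
  assert (Hstep : forall n, W_int a n / S_int a n =
    W_int a (n + 2) / S_int a (n + 2) + 2 * a / (INR (n + 2) ^ 2 - a ^ 2)).
  { intros n.
    pose proof (S_int_pos a n Ha). pose proof (S_int_pos a (n + 2) Ha).
    pose proof (S_int_rec a n) as HS. pose proof (W_int_rec a n) as HW.
    assert (Hn1 : 0 < INR (n + 2) * INR (n + 1)) by
      (apply Rmult_lt_0_compat; apply lt_0_INR; lia).
    assert (Hn2 : 2 <= INR (n + 2)) by
      (rewrite plus_INR; simpl; pose proof (pos_INR n); lra).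
    assert (Hd : 0 < INR (n + 2) ^ 2 - a ^ 2) by nra.
    transitivity ((INR (n + 2) * INR (n + 1) * W_int a n) /
      (INR (n + 2) * INR (n + 1) * S_int a n)).
    - field. split; [lra|]. split; apply not_0_INR; lia.
    - rewrite <- HS, <- HW. field. lra. }
  (* The cotangent enters through the initial ratio of the telescoping sum. *)
  assert (H0 : W_int a 0 / S_int a 0 =
    1 / a - PI / 2 * cos (a * (PI / 2)) / sin (a * (PI / 2))).
  { rewrite W_int_0, S_int_0 by lra.
    assert (0 < sin (a * (PI / 2))) by (pose proof PI_RGT_0; apply sin_gt_0; nra).
    field. lra. }
  induction k as [|k IH].
  - rewrite <- H0, (Hstep 0%nat). unfold sum_f_R0, pole.
    change (0 + 2)%nat with 2%nat. change (2 * 0 + 2)%nat with 2%nat.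
    change (INR 1) with 1. change (INR 2) with 2. rewrite Rmult_1_r. ring.
  - rewrite tech5, IH, (Hstep (2 * k + 2)%nat).
    replace (2 * S k + 2)%nat with (2 * k + 2 + 2)%nat by lia.
    replace (pole (S k)) with (INR (2 * k + 2 + 2)); [ring|].
    unfold pole. rewrite !plus_INR, mult_INR, !S_INR. simpl. ring.
Qed.

Lemma cot_partial_fractions (a : R) : 0 < a < 1 ->
  is_series (fun k => 2 * a / (pole k ^ 2 - a ^ 2))
    (1 / a - PI / 2 * cos (a * (PI / 2)) / sin (a * (PI / 2))).
Proof.
  intros Ha. set (L := 1 / a - _).
  assert (H : is_lim_seq (fun k => L - W_int a (2 * k + 2) / S_int a (2 * k + 2)) L).
  { apply is_lim_seq_le_le with (fun k => L - / INR (S k)) (fun _ => L).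
    - intros k.
      pose proof (S_int_pos a (2 * k + 2) Ha) as HS.
      pose proof (W_int_nonneg a (2 * k + 2) Ha) as HW.
      split.
      + apply Rplus_le_compat_l, Ropp_le_contravar.
        pose proof (W_int_le a (2 * k + 1) Ha) as Hle.
        replace (S (2 * k + 1)) with (2 * k + 2)%nat in Hle by lia.
        assert (H1 : 0 < INR (S k)) by (apply lt_0_INR; lia).
        assert (H2 : INR (S k) <= INR (2 * k + 2)) by (apply le_INR; lia).
        apply (Rmult_le_reg_l (INR (S k) * S_int a (2 * k + 2)));
          [now apply Rmult_lt_0_compat|].
        replace (INR (S k) * S_int a (2 * k + 2) * (W_int a (2 * k + 2) / S_int a (2 * k + 2)))
          with (INR (S k) * W_int a (2 * k + 2)) by (field; lra).
        replace (INR (S k) * S_int a (2 * k + 2) * / INR (S k))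
          with (S_int a (2 * k + 2)) by (field; lra).
        nra.
      + pose proof (Rdiv_le_0_compat _ _ HW HS). lra.
    - replace (Finite L) with (Finite (L - 0)) by (f_equal; ring).
      apply is_lim_seq_minus'; [apply is_lim_seq_const|].
      apply (is_lim_seq_incr_1 (fun n => / INR n)).
      apply (is_lim_seq_inv _ p_infty is_lim_seq_INR). discriminate.
    - apply is_lim_seq_const. }
  apply (filterlim_ext (fun k => L - W_int a (2 * k + 2) / S_int a (2 * k + 2))).
  - intros k. rewrite sum_n_Reals. symmetry. now apply cot_partial_sum.
  - exact H.
Qed.

(** * Zeta values and the tangent *)

(** The coefficient of [a^(2j+1)] once each [2a/(p^2 - a^2)] is expanded as a geometric series. *)
Definition pole_sum (j : nat) : R := Series (fun k => 2 / pole k ^ (2 * j + 2)).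

Lemma pole_sum_zeta (n : nat) : pole_sum n = 2 / 4 ^ (n + 1) * zeta (INR (2 * (n + 1))).
Proof.
  unfold pole_sum, zeta. rewrite <- Series_scal_l. apply Series_ext. intros k.
  assert (Hk : 0 < INR (S k)) by (apply lt_0_INR; lia).
  rewrite Rpower_pow by easy. unfold pole.
  replace (2 * n + 2)%nat with (2 * (n + 1))%nat by lia.
  rewrite Rpow_mult_distr, (pow_mult 2). replace (2 ^ 2) with 4 by ring.
  field. split; apply pow_nonzero; lra.
Qed.

Lemma pole_term_bounds (a : R) (k j : nat) : 0 < a < 1 ->
  0 < 2 / pole k ^ (2 * j + 2) <= 2 / (pole k ^ 2 - a ^ 2).
Proof.
  intros Ha. pose proof (pole_ge_2 k) as Hk.
  assert (H1 : 0 < pole k ^ 2 - a ^ 2) by nra.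
  assert (H2 : pole k ^ 2 - a ^ 2 <= pole k ^ (2 * j + 2)).
  { apply Rle_trans with (pole k ^ 2); [nra|]. apply Rle_pow; [lra|lia]. }
  split; [apply Rdiv_lt_0_compat; lra|].
  apply Rmult_le_compat_l; [lra|]. now apply Rinv_le_contravar.
Qed.

Lemma is_series_pole_sum (j : nat) : is_series (fun k => 2 / pole k ^ (2 * j + 2)) (pole_sum j).
Proof.
  apply Series_correct.
  (* The dominating series is the partial fraction series itself at [a = 1/2], doubled because
     [2a = 1]. *)
  apply (ex_series_le (K := R_AbsRing) (V := R_CompleteNormedModule) _
    (fun k => 2 / (pole k ^ 2 - (/ 2) ^ 2))).
  - intros k. pose proof (pole_term_bounds (/ 2) k j ltac:(lra)).
    change (Rabs (2 / pole k ^ (2 * j + 2)) <= 2 / (pole k ^ 2 - (/ 2) ^ 2)).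
    rewrite Rabs_pos_eq; lra.
  - eexists. eapply is_series_ext; [|apply (is_series_scal 2), (cot_partial_fractions (/ 2)); lra].
    intros k. pose proof (pole_ge_2 k).
    change (2 * (2 * / 2 / (pole k ^ 2 - (/ 2) ^ 2)) = 2 / (pole k ^ 2 - (/ 2) ^ 2)).
    field. nra.
Qed.

Lemma is_series_le (u v : nat -> R) (U V : R) :
  (forall k, 0 <= u k <= v k) -> is_series u U -> is_series v V -> U <= V.
Proof.
  intros Huv HU HV. rewrite <- (is_series_unique _ _ HU), <- (is_series_unique _ _ HV).
  apply Series_le; [easy|now exists V].
Qed.

Definition cot_tail (a : R) : R :=
  1 / a - PI / 2 * cos (a * (PI / 2)) / sin (a * (PI / 2)).

(** The two summations are exchanged by a squeeze. The partial sum up to [a^(2N)] is the sum over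
    [k] of [g k (1 - rho k^(N+1))], and [rho k <= 1/4] puts it between [(1 - 4^(-N-1)) L] and
    [L]. *)
Lemma cot_tail_even_part (a : R) : 0 < a < 1 ->
  is_pseries pole_sum (a ^ 2) (cot_tail a / a).
Proof.
  intros Ha.
  set (g := fun k => 2 / (pole k ^ 2 - a ^ 2)).
  set (rho := fun k => (a / pole k) ^ 2).
  assert (Hrho : forall k, 0 <= rho k <= / 4).
  { intros k. pose proof (pole_ge_2 k). split; [apply pow2_ge_0|].
    unfold rho. replace (/ 4) with ((1 / 2) ^ 2) by field. apply pow_incr.
    split; [apply Rdiv_le_0_compat; lra|].
    apply (Rmult_le_reg_r (pole k)); [lra|]. unfold Rdiv at 1.
    rewrite Rmult_assoc, Rinv_l; lra. }
  assert (Hg0 : forall k, 0 <= g k).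
  { intros k. pose proof (pole_ge_2 k). apply Rdiv_le_0_compat; nra. }
  assert (Hg : is_series g (cot_tail a / a)).
  { replace (cot_tail a / a) with (/ a * cot_tail a) by (field; lra).
    refine (is_series_ext _ _ _ _ (is_series_scal (/ a) _ _ (cot_partial_fractions a Ha))).
    intros k. pose proof (pole_ge_2 k).
    change (/ a * (2 * a / (pole k ^ 2 - a ^ 2)) = g k). unfold g.
    field. split; nra. }
  assert (Hpart : forall N, is_series (fun k => g k * (1 - rho k ^ S N))
    (sum_f_R0 (fun j => pole_sum j * (a ^ 2) ^ j) N)).
  { assert (Hterm : forall j, is_series (fun k => (a ^ 2) ^ j * (2 / pole k ^ (2 * j + 2)))
      (pole_sum j * (a ^ 2) ^ j)).
    { intros j. rewrite Rmult_comm.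
      exact (is_series_scal ((a ^ 2) ^ j) _ _ (is_series_pole_sum j)). }
    intros N. induction N as [|N IH].
    - simpl sum_f_R0. refine (is_series_ext _ _ _ _ (Hterm 0%nat)).
      intros k. cbv beta. at_R. unfold g, rho. simpl. pose proof (pole_ge_2 k).
      field. split; nra.
    - rewrite tech5.
      refine (is_series_ext _ _ _ _ (is_series_plus _ _ _ _ IH (Hterm (S N)))).
      intros k. change (g k * (1 - rho k ^ S N) + (a ^ 2) ^ S N * (2 / pole k ^ (2 * S N + 2))
        = g k * (1 - rho k ^ S (S N))).
      pose proof (pole_ge_2 k).
      assert (Hpow : rho k ^ S N = (a ^ 2) ^ S N / pole k ^ (2 * S N)).
      { unfold rho, Rdiv. now rewrite !Rpow_mult_distr, !pow_inv, pow_mult. }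
      rewrite <- (tech_pow_Rmult _ (S N)), Hpow, pow_add.
      unfold g, rho.
      assert (pole k ^ (2 * S N) <> 0) by (apply pow_nonzero; lra).
      field. repeat split; nra. }
  apply is_pseries_R.
  apply (filterlim_ext (sum_f_R0 (fun j => pole_sum j * (a ^ 2) ^ j)));
    [intros N; symmetry; apply sum_n_Reals|].
  set (L := cot_tail a / a) in *.
  apply (is_lim_seq_le_le (fun N => L - (/ 4) ^ S N * L) _ (fun _ => L) (Finite L)).
  - intros N. split.
    + apply (is_series_le (fun k => g k - (/ 4) ^ S N * g k) (fun k => g k * (1 - rho k ^ S N))).
      * intros k. pose proof (Hg0 k).
        assert ((/ 4) ^ S N <= 1).
        { rewrite <- (pow1 (S N)). apply pow_incr. lra. }
        assert (rho k ^ S N <= (/ 4) ^ S N) by (apply pow_incr, Hrho).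
        split; nra.
      * apply (is_series_minus g (fun k => (/ 4) ^ S N * g k)); [easy|].
        exact (is_series_scal ((/ 4) ^ S N) _ _ Hg).
      * apply Hpart.
    + apply (is_series_le (fun k => g k * (1 - rho k ^ S N)) g); auto.
      intros k. pose proof (Hg0 k). pose proof (Hrho k).
      assert (0 <= rho k ^ S N) by (apply pow_le; lra).
      assert (rho k ^ S N <= 1).
      { rewrite <- (pow1 (S N)). apply pow_incr. lra. }
      split; nra.
  - replace (Finite L) with (Finite (L - 0 * L)) by (f_equal; ring).
    apply is_lim_seq_minus'; [apply is_lim_seq_const|].
    apply is_lim_seq_mult'; [|apply is_lim_seq_const].
    apply (is_lim_seq_incr_1 (fun n => (/ 4) ^ n)).
    apply is_lim_seq_geom. rewrite Rabs_pos_eq; lra.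
  - apply is_lim_seq_const.
Qed.

Definition cot_tail_coef (m : nat) : R :=
  if Nat.even m then 0 else pole_sum (Nat.div2 m).

Lemma cot_tail_coef_even (n : nat) : cot_tail_coef (2 * n) = 0.
Proof. unfold cot_tail_coef. now rewrite Nat.even_even. Qed.

Lemma cot_tail_coef_odd (n : nat) : cot_tail_coef (2 * n + 1) = pole_sum n.
Proof.
  unfold cot_tail_coef.
  rewrite Nat.even_odd, Nat.add_1_r, Nat.div2_succ_double. reflexivity.
Qed.

Lemma expands_cot_tail : expands cot_tail_coef cot_tail.
Proof.
  exists 1. split; [lra|]. intros a Ha.
  replace (cot_tail a) with (0 + a * (cot_tail a / a)) by (field; lra).
  apply is_pseries_odd_even.
  - apply is_pseries_R. apply (is_series_ext (fun _ => 0)).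
    + intros n. rewrite cot_tail_coef_even. at_R. ring.
    + apply (filterlim_ext (fun _ : nat => 0)); [|apply filterlim_const].
      intros n. rewrite sum_n_Reals. symmetry. now apply sum_f_R0_zero.
  - apply (is_pseries_ext pole_sum); [|now apply cot_tail_even_part].
    intros n. symmetry. apply cot_tail_coef_odd.
Qed.

(** From [tan (a PI/2) = 2/PI (2 cot_tail (2a) - cot_tail a)] with [a = x/PI]: doubling the argument
    gives [2^(m+1)], rescaling gives [PI^m]. *)
Definition half_tan_coef (m : nat) : R :=
  2 / PI * (2 ^ (m + 1) - 1) * cot_tail_coef m / PI ^ m.

(* [tan y = cot y - 2 cot (2 y)] at [y = a PI/2] *)
Lemma tan_cot_tail (a : R) : 0 < a < 1 / 2 ->
  tan (a * (PI / 2)) = 2 / PI * (2 * cot_tail (2 * a) + -1 * cot_tail a).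
Proof.
  intros Ha. unfold cot_tail, tan. pose proof PI_RGT_0.
  replace (2 * a * (PI / 2)) with (2 * (a * (PI / 2))) by ring.
  set (y := a * (PI / 2)).
  assert (0 < sin y) by (apply sin_gt_0; unfold y; nra).
  assert (0 < cos y) by (apply cos_gt_0; unfold y; nra).
  rewrite sin_2a, cos_2a. field. repeat split; lra.
Qed.

Lemma expands_half_tan : expands half_tan_coef (fun x => tan (x / 2)).
Proof.
  pose proof PI_RGT_0 as Hpi.
  assert (H := expands_scal (2 / PI) _ _ (expands_plus _ _ _ _
    (expands_scal 2 _ _ (expands_dilate 2 _ _ ltac:(lra) expands_cot_tail))
    (expands_scal (-1) _ _ expands_cot_tail))).
  apply (expands_dilate (/ PI)) in H; [|now apply Rinv_0_lt_compat].
  revert H. apply expands_ext.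
  - intros n. unfold half_tan_coef. rewrite pow_add, pow_inv. unfold Rdiv. ring.
  - exists 1. split; [lra|]. intros x Hx. cbv beta.
    rewrite <- tan_cot_tail.
    + f_equal. field. lra.
    + pose proof PI2_1.
      split; [apply Rmult_lt_0_compat; [now apply Rinv_0_lt_compat|lra]|].
      apply (Rmult_lt_reg_l PI); [lra|]. rewrite <- Rmult_assoc, Rinv_r by lra. lra.
Qed.

Lemma half_tan_coef_even (n : nat) : half_tan_coef (2 * n) = 0.
Proof. unfold half_tan_coef. rewrite cot_tail_coef_even. unfold Rdiv. ring. Qed.

(** At [m = 2n-1] the factor [2^(m+1) - 1] is [4^n - 1], and [pole_sum (n-1) = 2 zeta(2n) / 4^n]. *)
Lemma half_tan_coef_zeta (n : nat) : (1 <= n)%nat ->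
  zeta (INR (2 * n)) =
  PI ^ (2 * n) * (4 ^ (n - 1) / (4 ^ n - 1)) * half_tan_coef (2 * n - 1).
Proof.
  intros Hn. destruct n as [|n]; [lia|].
  replace (2 * S n - 1)%nat with (2 * n + 1)%nat by lia.
  replace (S n - 1)%nat with n by lia.
  unfold half_tan_coef. rewrite cot_tail_coef_odd, pole_sum_zeta.
  replace (2 * n + 1 + 1)%nat with (2 * S n)%nat by lia.
  replace (n + 1)%nat with (S n) by lia.
  rewrite (pow_mult 2). replace (2 ^ 2) with 4 by ring.
  replace (PI ^ (2 * S n)) with (PI * PI ^ (2 * n + 1))
    by (replace (2 * S n)%nat with (S (2 * n + 1)) by lia; reflexivity).
  pose proof PI_RGT_0.
  assert (0 < PI ^ (2 * n + 1)) by now apply pow_lt.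
  assert (1 <= 4 ^ n) by (apply pow_R1_Rle; lra).
  set (z := zeta _). simpl (4 ^ S n). field. lra.
Qed.

(** * Derivatives of the tangent and even Bernoulli numbers *)

Lemma Derive_n_tan (q : nat -> R) (m : nat) :
  expands q (fun x => tan (x / 2)) -> (forall n, q (2 * n)%nat = 0) ->
  Derive_n tan m 0 = INR (fact m) * 2 ^ m * q m.
Proof.
  intros Hq Hq0.
  set (p := fun n => q n * 2 ^ n).
  assert (Hp : expands p tan).
  { generalize (expands_dilate 2 _ _ ltac:(lra) Hq). apply expands_ext; [easy|].
    exists 1. split; [lra|]. intros x _. f_equal. field. }
  (* The expansion is known only for [x > 0]; oddness of both sides carries it to a neighbourhood of
     0. *)
  assert (Hodd : forall x, PSeries p (- x) = - PSeries p x).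
  { intros x. unfold PSeries. rewrite <- Series_opp. apply Series_ext. intros n.
    unfold p. destruct (Nat.Even_or_Odd n) as [[k ->]|[k ->]].
    - rewrite Hq0. ring.
    - replace (- x) with (-1 * x) by ring.
      rewrite (Rpow_mult_distr (-1)), (pow_add (-1)), pow_1_even. ring. }
  pose proof (expands_radius_pos _ _ Hp) as Hcv.
  destruct Hp as (r & Hr & Htan).
  rewrite (Derive_n_ext_loc tan (PSeries p)).
  - rewrite Derive_n_coef by easy. unfold p. ring.
  - exists (mkposreal r Hr). intros x Hx.
    change (Rabs (x - 0) < r) in Hx. rewrite Rminus_0_r in Hx. apply Rabs_def2 in Hx.
    destruct (Rtotal_order x 0) as [Hx0|[->|Hx0]].
    + rewrite <- (Ropp_involutive x), tan_neg, Hodd.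
      f_equal. symmetry. apply is_pseries_unique, Htan. lra.
    + rewrite tan_0, PSeries_0. unfold p.
      replace (q 0%nat) with 0 by (symmetry; apply (Hq0 0%nat)). ring.
    + symmetry. apply is_pseries_unique, Htan. lra.
Qed.

(** The coefficient of [x^(2n-1)] in [tanh (x/2)] is [2 (4^n - 1) B_(2n) / (2n)!] on one side and
    [(-1)^(n-1)] times that of [tan (x/2)] on the other. *)
Lemma bernoulli_even (B : nat -> C) (n : nat) : is_bernoulli B -> (1 <= n)%nat ->
  B (2 * n)%nat = RtoC ((-1) ^ (n + 1) *
    (INR (fact (2 * n)) * half_tan_coef (2 * n - 1) / (2 * (4 ^ n - 1)))).
Proof.
  intros HB Hn. destruct (bernoulli_series B HB) as [HRe HIm].
  pose proof (INR_fact_pos (2 * n)) as Hf.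
  apply injective_projections;
    [match goal with |- _ = fst (RtoC ?r) => change (Re (B (2 * n)%nat) = r) end
    |change (Im (B (2 * n)%nat) = 0)].
  - pose proof (half_tanh_coef_eq _ _ expands_half_tan half_tan_coef_even
      (expands_half_tanh _ HRe) (2 * n - 1)) as H.
    destruct n as [|n]; [lia|].
    replace (2 * S n - 1)%nat with (S (2 * n)) in * by lia.
    rewrite Nat.div2_succ_double in H.
    unfold half_tanh_coef in H.
    replace (S (S (2 * n))) with (2 * S n)%nat in H by lia.
    rewrite (pow_mult 2) in H. replace (2 ^ 2) with 4 in H by ring.
    assert (H4 : 4 <= 4 ^ S n) by (simpl; pose proof (pow_R1_Rle 4 n ltac:(lra)); lra).
    replace ((-1) ^ (S n + 1)) with ((-1) ^ n) by (rewrite pow_add; simpl; ring).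
    simpl Nat.eqb in H.
    transitivity (INR (fact (2 * S n)) / (2 * (4 ^ S n - 1)) *
      (0 + 2 * (4 ^ S n - 1) * (Re (B (2 * S n)%nat) / INR (fact (2 * S n))))).
    + field. lra.
    + rewrite H. field. lra.
  - pose proof (expands_zero (2 * n) _ HIm) as H. cbv beta in H.
    replace (Im (B (2 * n)%nat)) with
      (Im (B (2 * n)%nat) / INR (fact (2 * n)) * INR (fact (2 * n))) by (field; lra).
    rewrite H. ring.
Qed.

Theorem theorem4p8 :
  forall n : nat, (3 <= n)%nat ->
    zeta (INR (2 * n)) =
      PI ^ (2 * n) / INR (fact (2 * n)) * (4 ^ (n - 1) / (4 ^ n - 1)) * b_seq n /\
    (forall B : nat -> C, is_bernoulli B ->
       B (2 * n)%nat = RtoC ((-1) ^ (n + 1) * (b_seq n / (2 * (4 ^ n - 1))))) /\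
    Derive_n tan (2 * n - 1) 0 = 4 ^ (n - 1) / INR n * b_seq n.
Proof.
  intros n Hn.
  (* Subtracting [x/2] changes only the coefficient of [x], and [2n-1 >= 5]. *)
  assert (Hb : b_seq n = INR (fact (2 * n)) * half_tan_coef (2 * n - 1)).
  { rewrite (b_seq_eq _ n (half_tan_power_array _ expands_half_tan) Hn). replace (PS_pow (half_tan_tail half_tan_coef) 1 (2 * n - 1)%nat)
      with (half_tan_tail half_tan_coef (2 * n - 1)%nat) by (symmetry; apply PS_pow_1).
    replace (2 * n - 1)%nat with (S (S (2 * n - 3))) by lia.
    unfold half_tan_tail. simpl PS_incr_1. ring. }
  pose proof (INR_fact_pos (2 * n)) as Hf.
  rewrite Hb. split; [|split].
  - rewrite half_tan_coef_zeta by lia.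
    assert (1 < 4 ^ n) by (apply Rlt_pow_R1; [lra|lia]).
    field. lra.
  - intros B HB. apply bernoulli_even; [easy|lia].
  - rewrite (Derive_n_tan _ _ expands_half_tan half_tan_coef_even).
    destruct n as [|n]; [lia|].
    replace (2 * S n - 1)%nat with (S (2 * n)) by lia.
    (* Writing [(2n)! = 2n (2n-1)!] and [2^(2n-1) = 2 * 4^(n-1)] produces the factor [4^(n-1)/n]. *)
    replace (fact (2 * S n)) with (fact (S (S (2 * n)))) by (f_equal; lia).
    rewrite (INR_fact_S (S (2 * n))).
    replace (INR (S (S (2 * n)))) with (2 * INR (S n))
      by (rewrite !S_INR, mult_INR; simpl; ring).
    replace (S n - 1)%nat with n by lia.
    rewrite <- tech_pow_Rmult, pow_mult. replace (2 ^ 2) with 4 by ring.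
    field. apply not_0_INR. lia.
Qed.
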